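(* Let $G$ be a countable infinite discrete group, let $(X,\beta G)$ be a $\beta G$-action and let $S$ be a nonempty closed subsemigroup of $\beta G\setminus G$. If $K(\beta G)\subset S$, then a point $x\in X$ is distal if and only if $x$ is $S$-product recurrent.
   Context: $\beta G$ is the Stone-Čech compactification of the discrete group $G$: the set of ultrafilters on $G$ with basis of open sets $\{p\in\beta G: A\in p\}$, $A\subset G$, and operation $p\cdot q=\{A\subset G:\{g\in G: g^{-1}A\in q\}\in p\}$. It is a compact Hausdorff right topological semigroup (for every $p$ the map $q\mapsto q\cdot p$ is continuous), and $G$ is identified with the set of principal ultrafilters. $K(\beta G)$ is the smallest two-sided ideal of $\beta G$ (the union of all minimal left ideals). A $\beta G$-action $(X,\beta G)$ on a compact Hausdorff space $X$ is a map $\beta G\times X\to X$, $(p,x)\mapsto px$, such that $p(qx)=(pq)x$ for all $p,q\in\beta G$, $x\in X$, and such that for each $x\in X$ the map $\beta G\to X$, $p\mapsto px$, is continuous (the maps $x\mapsto px$ are not assumed continuous). For $\beta G$-actions $(X,\beta G)$ and $(Y,\beta G)$, the product action $(X\times Y,\beta G)$ is $p(x,y)=(px,py)$. A pair $(x,y)\in X\times X$ is proximal if $px=py$ for some $p\in\beta G$, and distal otherwise. A point $x\in X$ is distal if for every $y\in\beta G\,x=\{px:p\in\beta G\}$ with $y\neq x$, the pair $(x,y)$ is distal. A point $x\in X$ is $S$-recurrent if $px=x$ for some $p\in S$. A point $x\in X$ is $S$-product recurrent if for any $\beta G$-action $(Y,\beta G)$ (on a compact Hausdorff space $Y$) and any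 $S$-recurrent point $y\in Y$, the point $(x,y)$ is $S$-recurrent in $(X\times Y,\beta G)$. *)

(* Defs.v *)
From HB Require Import structures.
From mathcomp Require Import all_boot.
From mathcomp Require Import boolp classical_sets functions cardinality.
From mathcomp Require Import filter topology.

Set Implicit Arguments.
Unset Strict Implicit.
Unset Printing Implicit Defensive.

Local Open Scope classical_set_scope.
Local Open Scope group_scope.

(* [uf_sets p A] (written [p A]) reads "A belongs to the ultrafilter p". *)
Record ultrafilter (T : Type) := Ultrafilter {
  uf_sets :> set T -> Prop;
  uf_ultra : UltraFilter uf_sets
}.

Lemma uf_eqP (T : Type) (p q : ultrafilter T) :
  (forall A : set T, p A <-> q A) -> p = q.
Proof.
case: p q => [p up] [q uq] /= pq.
have e : p = q by apply/funext => A; apply/propext.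
by subst q; congr Ultrafilter; exact: Prop_irrelevance.
Qed.

Lemma ultrafilter_setC (T : Type) (F : set_system T) :
  ProperFilter F -> (forall A, F A \/ F (~` A)) -> UltraFilter F.
Proof.
move=> FF FC; split=> // H HF FH; rewrite eqEsubset; split=> // A HA.
have [//|/FH HnA] := FC A.
have /filter_ex [x []] : H (A `&` ~` A) by exact: filterI.
by [].
Qed.

HB.instance Definition _ (T : Type) := gen_eqMixin (ultrafilter T).
HB.instance Definition _ (T : Type) := gen_choiceMixin (ultrafilter T).

Definition principal (T : Type) (x : T) : ultrafilter T :=
  Ultrafilter (principal_filter_ultra x).

Section UltrafilterTopology.
Variable T : Type.

Definition uf_base (A : set T) : set (ultrafilter T) :=
  [set p : ultrafilter T | p A].

Lemma uf_base_cover : \bigcup_(A in [set: set T]) uf_base A = setT.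
Proof.
apply/seteqP; split=> // p _; exists setT => //.
by have ? := uf_ultra p; exact: (@filterT _ p).
Qed.

Lemma uf_base_join (A B : set T) (p : ultrafilter T) :
  [set: set T] A -> [set: set T] B -> uf_base A p -> uf_base B p ->
  exists C, [/\ [set: set T] C, uf_base C p
              & uf_base C `<=` uf_base A `&` uf_base B].
Proof.
move=> _ _ pA pB; exists (A `&` B); split=> //.
  by have ? := uf_ultra p; exact: (@filterI _ p).
by move=> q qAB; have ? := uf_ultra q;
  split; apply: (@filterS _ q) qAB => // x [].
Qed.

HB.instance Definition _ := isBaseTopological.Build (ultrafilter T)
  uf_base_cover uf_base_join.

End UltrafilterTopology.

Section UltrafilterSemigroup.
Variable G : groupType.
Implicit Types (p q r : ultrafilter G) (A B : set G).

Definition ltranslate (g : G) A : set G := [set g * a | a in A].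

Lemma ltranslateVE g A : ltranslate g^-1 A = [set h | A (g * h)].
Proof.
apply/seteqP; split=> h /=; first by case=> a Aa <-; rewrite mulVKg.
by move=> Agh; exists (g * h); rewrite ?mulKg.
Qed.

Definition uf_mul_sets p q : set G -> Prop :=
  fun A => p [set g | q (ltranslate g^-1 A)].

Lemma uf_mul_ultra p q : UltraFilter (uf_mul_sets p q).
Proof.
have up := uf_ultra p; have uq := uf_ultra q; rewrite /uf_mul_sets.
apply: ultrafilter_setC.
  apply: Build_ProperFilter_ex.
    move=> A /filter_ex[g /= /filter_ex[h]].
    by rewrite ltranslateVE => Agh; exists (g * h).
  split.
  - rewrite (_ : mkset _ = setT); first exact: (@filterT _ p).
    by apply/seteqP; split=> // g _ /=; rewrite ltranslateVE; exact: (@filterT _ q).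
  - move=> A B pA pB; apply: (@filterS _ p) (@filterI _ p _ _ _ pA pB) => g /=.
    by rewrite !ltranslateVE => -[qA qB]; exact: (@filterI _ q).
  - move=> A B AB; apply: (@filterS _ p) => g /=; rewrite !ltranslateVE.
    by apply: (@filterS _ q) => h /= /AB.
move=> A; have [?|pC] := in_ultra_setVsetC [set g | q (ltranslate g^-1 A)] up.
  by left.
right; apply: (@filterS _ p) pC => g /=; rewrite !ltranslateVE => nq.
by have [//|] := in_ultra_setVsetC [set h | A (g * h)] uq.
Qed.

Definition uf_mul p q : ultrafilter G := Ultrafilter (uf_mul_ultra p q).

Lemma uf_mulA : associative uf_mul.
Proof.
move=> p q r; apply: uf_eqP => A /=; rewrite /uf_mul_sets /= /uf_mul_sets.
suff -> : [set g | q [set h | r (ltranslate h^-1 (ltranslate g^-1 A))]] =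
    [set g | q (ltranslate g^-1 [set h | r (ltranslate h^-1 A)])] by [].
apply/funext => g; rewrite /mkset ltranslateVE; congr (uf_sets q _).
apply/funext => h; rewrite /mkset !ltranslateVE; congr (uf_sets r _).
by rewrite ltranslateVE; apply/funext => k; rewrite /mkset mulgA.
Qed.

HB.instance Definition _ := isSemigroup.Build (ultrafilter G) uf_mulA.

End UltrafilterSemigroup.

(* For a discrete group G, [beta G] carries the topology generated by the
   [uf_base A], and [p * q] is [uf_mul p q]. *)
Notation beta := ultrafilter.

Section Ideals.
Variable M : semigroupType.

Definition subsemigroup (S : set M) :=
  forall p q, S p -> S q -> S (p * q).

Definition two_sided_ideal (I : set M) :=
  I !=set0 /\ forall p q, I q -> I (p * q) /\ I (q * p).

(* The smallest two-sided ideal, as the intersection of all of them. *)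
Definition K : set M := smallest two_sided_ideal set0.

End Ideals.
Arguments K : clear implicits.

(* Compactness and separation of X are stated separately where X is
   introduced. Neither continuity in X nor an identity axiom is required. *)
Record beta_action (G : groupType) (X : topologicalType) := BetaAction {
  act :> beta G -> X -> X;
  actA : forall (p q : beta G) (x : X), act p (act q x) = act (p * q) x;
  act_continuous : forall x : X, continuous (fun p : beta G => act p x)
}.

Section ProductAction.
Variables (G : groupType) (X Y : topologicalType).
Variables (a : beta_action G X) (b : beta_action G Y).

Definition prod_act (p : beta G) (z : X * Y) : X * Y := (a p z.1, b p z.2).

Lemma prod_actA (p q : beta G) (z : X * Y) :
  prod_act p (prod_act q z) = prod_act (p * q) z.
Proof. by rewrite /prod_act /= !actA. Qed.

Lemma prod_act_continuous (z : X * Y) :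
  continuous (fun p : beta G => prod_act p z).
Proof.
move=> p; apply: (@cvg_pair _ _ _ _ (nbhs (a p z.1)) (nbhs (b p z.2))).
- exact: nbhs_filter.
- exact: (@act_continuous _ _ a z.1 p).
- exact: (@act_continuous _ _ b z.2 p).
Qed.

Definition prod_action : beta_action G (X * Y)%type :=
  BetaAction prod_actA prod_act_continuous.

End ProductAction.

Section Dynamics.
Variables (G : groupType) (X : topologicalType) (a : beta_action G X).

Definition proximal_pair (x y : X) := exists p : beta G, a p x = a p y.

Definition distal_pair (x y : X) := ~ proximal_pair x y.

Definition beta_orbit (x : X) : set X := [set a p x | p in [set: beta G]].

Definition distal_point (x : X) :=
  forall y, beta_orbit x y -> y <> x -> distal_pair x y.

Definition recurrent (S : set (beta G)) (x : X) :=
  exists2 p : beta G, S p & a p x = x.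

End Dynamics.

Definition product_recurrent (G : groupType) (X : topologicalType)
    (a : beta_action G X) (S : set (beta G)) (x : X) :=
  forall (Y : topologicalType) (b : beta_action G Y),
    compact [set: Y] -> hausdorff_space Y ->
    forall y : Y, recurrent b S y -> recurrent (prod_action a b) S (x, y).

(* Main.v *)
Require Import Defs.
From mathcomp Require Import all_boot.
From mathcomp Require Import boolp classical_sets functions cardinality.
From mathcomp Require Import filter topology.

Set Implicit Arguments.
Unset Strict Implicit.
Unset Printing Implicit Defensive.

Local Open Scope classical_set_scope.

(** If [x] is distal and [u] is idempotent, then [x] and [u x] have the same
    image under [u], so [u x = x]. Given an [S]-recurrent [y], the elements of
    [S] that fix [y] form a nonempty closed subsemigroup, which contains an
    idempotent by the Ellis-Numakura lemma; it fixes both [x] and [y]. This is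
    one direction.

    For the converse it is enough that every idempotent [u] of a minimal left
    ideal fixes the product recurrent point [x]
    ([fixed_by_minimal_idempotents_distal]): if [p x = p y] with [y = q x], then
    [x] and [y] agree under a whole minimal left ideal, which contains an
    idempotent fixing [x] and an idempotent fixing [y].

    Suppose that [u x <> x] for such a [u]. By continuity of [t |-> t x] there
    is [D] in [u] such that [t x <> x] for all [t] containing [D]. Hence it is
    enough to find an [S]-recurrent point [F] of the shift on subsets of [G]
    whose return times in [S] all contain [D]. The point used here satisfies
    [1 \in F] and [F `<=` D `|` [set 1]]. A return time [t] of [F] contains [F],
    since [1 \in F]; if [t] is in [S], it is nonprincipal, so it contains [D].
    Product recurrence applied to [F] thus gives a contradiction.

    The set [F] is a tree: it starts at [1], and to each [g] in [F] it attaches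
    the children [g * a] for [a] in a set [A g]. If the sets [g A_g] are pairwise
    disjoint and miss [1], and if all the [A g] belong to one ultrafilter [s],
    then [s F = F] ([branching_recurrent]). The whole difficulty is to find
    such an [s] in [S] with [A g] small enough to keep [F] inside
    [D `|` [set 1]] ([sparse_recurrent_set]). No [s] in a minimal left ideal will
    do: then [s = e s] for some idempotent [e] of [K (beta G)], which contradicts
    disjointness. A suitable [s] is a limit of minimal ultrafilters [t_n] taken
    from left ideals other than that of [u]; it lies in [S], which is closed and
    contains [K (beta G)]. The [t_n] have members [C_n] that belong to no
    translate [g u]. Therefore, at each stage, the translates of the earlier
    [C_m] can be removed from the sets of [u] among which [C_n] is sought. That
    every member of [u] belongs to some minimal ultrafilter outside the left
    ideal of [u] is [minimal_nearby]. *)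

(** * Minimal closed sets in compact spaces *)

(** A chain of nonempty closed sets generates a proper filter, and all its
    cluster points lie in every member of the chain. *)
Lemma closed_chain_bigcap (Z : topologicalType) (F : set (set Z)) :
  compact [set: Z] -> F !=set0 ->
  (forall A, F A -> closed A /\ A !=set0) -> total_on F subset ->
  \bigcap_(A in F) A !=set0.
Proof.
move=> cZ [A0 FA0] Fcl Ftot.
have FF : ProperFilter (filter_from F id).
  apply: filter_from_proper; last by move=> A /Fcl[].
  apply: filter_from_filter; first by exists A0.
  move=> A B FA FB; have [AB|BA] := Ftot _ _ FA FB.
    by exists A => // z Az; split=> //; exact: AB.
  by exists B => // z Bz; split=> //; exact: BA.
have [|z [_ zF]] := cZ _ FF; first by exists A0.
exists z => A FA; apply: (Fcl A FA).1 => B Bz.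
by apply: zF => //; exists A.
Qed.

(** Zorn's lemma for families [P] of nonempty closed sets that are defined by
    conditions stable under intersection, such as being a subsemigroup or a left
    ideal. *)
Lemma minimal_closed_set (Z : topologicalType) (P : set (set Z)) (C0 : set Z) :
  compact [set: Z] ->
  (forall C, P C -> closed C /\ C !=set0) ->
  (forall F, F `<=` P -> F !=set0 -> \bigcap_(A in F) A !=set0 ->
    P (\bigcap_(A in F) A)) ->
  P C0 ->
  exists C, [/\ P C, C `<=` C0 & forall C', P C' -> C' `<=` C -> C' = C].
Proof.
move=> cZ Pcl Pcap PC0.
(* Zorn_bigcup wants unions of chains to grow, so it is applied to the
   complements in [C0]; the empty chain corresponds to [C0] itself. *)
have [F FP Ftot|A [PA Amax]] := @Zorn_bigcup Z [set U | P (C0 `\` U)].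
  have [[U0 FU0]|F0] := pselect (F !=set0); last first.
    rewrite /= (_ : \bigcup_(X in F) X = set0) ?setD0//.
    by apply/seteqP; split=> // z [U FU]; case: F0; exists U.
  pose F' := [set C0 `\` U | U in F].
  have F'P : F' `<=` P by move=> _ [U /FP PU <-].
  have F'0 : F' !=set0 by exists (C0 `\` U0); exists U0.
  rewrite /= (_ : C0 `\` _ = \bigcap_(A in F') A).
    apply: Pcap => //; apply: closed_chain_bigcap => //; first by move=> A /F'P/Pcl.
    move=> _ _ [U FU <-] [V FV <-].
    have [UV|VU] := Ftot _ _ FU FV.
      by right; exact: setDS.
    by left; exact: setDS.
  apply/seteqP; split=> z.
    by move=> [C0z nz] _ [U FU <-]; split=> // Uz; apply: nz; exists U.
  move=> zF; split=> [|[U FU Uz]].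
    by have [] : (C0 `\` U0) z by apply: zF; exists U0.
  by have [] : (C0 `\` U) z by apply: zF; exists U.
exists (C0 `\` A); split=> // C' PC' C'A.
apply/seteqP; split=> // z [C0z nAz]; apply: contrapT => nC'z.
apply: (Amax (~` C')); last first.
  rewrite /= setDE setCK (_ : C0 `&` C' = C')//.
  by apply/setIidPr => w /C'A[].
split; last by move/(_ z nC'z).
by move=> w Aw /C'A[].
Qed.

(** * The space of ultrafilters *)

Section Ultrafilters.
Variable T : Type.
Implicit Types (p q : ultrafilter T) (A B : set T).

Lemma ufS p A B : A `<=` B -> p A -> p B.
Proof. by have ? := uf_ultra p; exact: (@filterS _ p). Qed.

Lemma ufI p A B : p A -> p B -> p (A `&` B).
Proof. by have ? := uf_ultra p; exact: (@filterI _ p). Qed.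

Lemma ufT p : p setT.
Proof. by have ? := uf_ultra p; exact: (@filterT _ p). Qed.

Lemma uf_ex p A : p A -> A !=set0.
Proof. by have ? := uf_ultra p; exact: (@filter_ex _ p). Qed.

Lemma uf_setC p A : p (~` A) <-> ~ p A.
Proof.
split=> [pC pA|npA]; first by have [x []] := uf_ex (ufI pA pC).
by have [] := in_ultra_setVsetC A (uf_ultra p).
Qed.

Lemma uf_setU p A B : p (A `|` B) -> p A \/ p B.
Proof.
move=> pAB; apply: contrapT => /not_orP[/uf_setC pA /uf_setC pB].
by have [x [[Ax|Bx] [nA nB]]] := uf_ex (ufI pAB (ufI pA pB)).
Qed.

Lemma uf_neq p q : p <> q -> exists2 A, p A & ~ q A.
Proof.
move=> pq; apply: contrapT => H; apply: pq; apply: uf_eqP => A.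
split=> [pA|qA]; apply: contrapT => nA; apply: H.
  by exists A.
by exists (~` A); [exact/uf_setC|move/uf_setC].
Qed.

Lemma open_uf_base A : open (uf_base A).
Proof.
by exists [set A] => //; apply/seteqP; split=> [p [_ -> //]|p pA]; exists A.
Qed.

Lemma nbhs_ufP p (U : set (ultrafilter T)) :
  nbhs p U <-> exists2 A, p A & uf_base A `<=` U.
Proof.
split=> [|[A pA AU]]; last first.
  by apply: filterS AU _; apply: open_nbhs_nbhs; split=> //; exact: open_uf_base.
rewrite nbhsE => -[V [[D _ <-] [A DA pA]] VU].
by exists A => // q qA; apply: VU; exists A.
Qed.

Lemma uf_hausdorff : hausdorff_space (ultrafilter T).
Proof.
move=> p q pq; apply: contrapT => /uf_neq[A pA /uf_setC qA].
have [||r [rA /uf_setC]] := pq (uf_base A) (uf_base (~` A)); last by [].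
  by apply/nbhs_ufP; exists A.
by apply/nbhs_ufP; exists (~` A).
Qed.

(** An ultrafilter [F] on ultrafilters converges to the family of all [A] such
    that [F]-almost every ultrafilter contains [A]. *)
Lemma uf_compact : compact [set: ultrafilter T].
Proof.
rewrite compact_ultra => F FU _.
have uF : UltraFilter [set A : set T | F (uf_base A)].
  apply: ultrafilter_setC.
    apply: Build_ProperFilter_ex.
      move=> A FA; have [p pA] := @filter_ex _ F _ _ FA; exact: (uf_ex pA).
    split=> /=.
    - by apply: (@filterS _ F) filterT => p _; exact: ufT.
    - move=> A B FA FB; apply: (@filterS _ F) (@filterI _ F _ _ _ FA FB) => p [].
      exact: ufI.
    - by move=> A B AB; apply: (@filterS _ F) => p; exact: ufS.
  move=> A; have [|FC] := in_ultra_setVsetC (uf_base A) FU; first by left.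
  by right; apply: filterS FC => p /uf_setC.
exists (Ultrafilter uF); split=> // U /nbhs_ufP[A FA AU].
exact: (@filterS _ F) AU FA.
Qed.

(** By compactness, [s] is a cluster point of the sequence; it contains [A]
    because it cannot contain the complement. *)
Lemma uf_limit (C : set (ultrafilter T)) (t : nat -> ultrafilter T) :
  closed C -> (forall n, C (t n)) ->
  exists2 s, C s & forall A n0, (forall n, (n0 <= n)%N -> t n A) -> s A.
Proof.
move=> cC Ct; have cptC := subclosed_compact cC uf_compact (@subsetT _ C).
have [|s [Cs clus]] := cptC (t @ \oo) _; first by exists 0%N => // n _; exact: Ct.
exists s => // A n0 tA; apply: contrapT => /uf_setC sA.
have [||r [rA /uf_setC]] := clus (uf_base A) (uf_base (~` A)); last by [].
  by exists n0.
by apply/nbhs_ufP; exists (~` A).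
Qed.

(** Closure under finite intersections. An injection [idx] into [nat] stands for
    an enumeration: only finitely many indices are below a given bound. *)
Lemma uf_bigcap_le (I : Type) (idx : I -> nat) p (P : I -> set T) n :
  injective idx -> (forall i, p (P i)) ->
  p [set x | forall i, (idx i <= n)%N -> P i x].
Proof.
move=> inj pP; suff : p [set x | forall i, (idx i < n.+1)%N -> P i x] by [].
elim: n.+1 => {n} [|n IH]; first by apply: ufS (ufT p).
have [[i in_]|ni] := pselect (exists i, idx i = n); last first.
  apply: ufS IH => x Px i; rewrite ltnS leq_eqVlt => /orP[/eqP in_|]; last exact: Px.
  by case: ni; exists i.
apply: ufS (ufI IH (pP i)) => x [Px Pix] j.
rewrite ltnS leq_eqVlt => /orP[/eqP jn|]; last exact: Px.
by rewrite (inj j i) // jn.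
Qed.

End Ultrafilters.

(** * The semigroup beta G *)

Section BetaSemigroup.
Local Open Scope group_scope.

Variable G : groupType.
Implicit Types (p q r u : beta G) (A B : set G).

Lemma uf_mulE p q A : (p * q) A = p [set g | q [set h | A (g * h)]].
Proof.
have -> : (p * q) A = p [set g | q (ltranslate g^-1 A)] by []; congr (uf_sets p _).
by apply/funext => g; rewrite /mkset ltranslateVE.
Qed.

Lemma uf_mul_principal g q A : (principal g * q) A = q [set h | A (g * h)].
Proof. rewrite uf_mulE /=; apply: propext; exact: principal_filterP. Qed.

Lemma uf_mulr_continuous q : continuous (fun p => p * q).
Proof.
move=> p U /nbhs_ufP[A pqA AU].
apply/nbhs_ufP; exists [set g | q [set h | A (g * h)]]; first by rewrite -uf_mulE.
by move=> r rA; apply: AU; have : (r * q)%g A by rewrite uf_mulE.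
Qed.

(** Left multiplication on [beta G] is itself an action, so that facts on orbits
    and stabilizers also apply to left ideals. *)
Definition translation_action : beta_action G (beta G) :=
  BetaAction (@mulgA (beta G)) uf_mulr_continuous.

Lemma closed_orbit (Y : topologicalType) (b : beta_action G Y) (y : Y) :
  hausdorff_space Y -> forall C, closed C -> closed [set b p y | p in C].
Proof.
move=> hY C cC; apply: compact_closed => //; apply: continuous_compact.
  exact/continuous_subspaceT/act_continuous.
exact: subclosed_compact cC (@uf_compact G) _.
Qed.

Lemma closed_stabilizer (Y : topologicalType) (b : beta_action G Y) (y : Y)
    (C : set (beta G)) :
  hausdorff_space Y -> closed C -> closed [set p | C p /\ b p y = y].
Proof.
move=> hY cC; have -> : [set p | C p /\ b p y = y] =
    C `&` (fun p => b p y) @^-1` [set y] by [].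
apply: closedI => //; apply: preimage_closed.
  by move=> p _; exact: act_continuous.
exact: accessible_closed_set1 (hausdorff_accessible hY) _.
Qed.

(** The Ellis-Numakura lemma: if [C] is a minimal closed subsemigroup and
    [p] is in [C], then [C p] and the stabilizer of [p] in [C] are closed
    subsemigroups, hence equal to [C], so that [p] fixes itself. *)
Lemma exists_idempotent (C : set (beta G)) :
  closed C -> C !=set0 -> subsemigroup C -> exists2 u, C u & u * u = u.
Proof.
move=> cC C0 sC.
have [| | |E [[cE E0 sE] EC Emin]] := @minimal_closed_set (beta G)
    [set E : set (beta G) | [/\ closed E, E !=set0 & subsemigroup E]] C (@uf_compact G).
- by move=> E [].
- move=> F FP _ F0; split=> //; first by apply: closed_bigI => E /FP[].
  move=> p q pF qF E FE; have [_ _] := FP E FE.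
  by apply; [exact: pF|exact: qF].
- by [].
case: E0 => p Ep; exists p; first exact: EC.
have EpE : [set q * p | q in E] = E.
  apply: Emin; last by move=> _ [q Eq <-]; exact: sE.
  split.
  - exact: (@closed_orbit _ translation_action p (@uf_hausdorff G)).
  - by exists (p * p); exists p.
  - move=> _ _ [q Eq <-] [r Er <-]; exists (q * p * r); last by rewrite mulgA.
    exact: (sE _ _ (sE _ _ Eq Ep) Er).
have stE : [set q | E q /\ q * p = p] = E.
  apply: Emin; last by move=> q [].
  split.
  - exact: (@closed_stabilizer _ translation_action p E (@uf_hausdorff G)).
  - by have: E p by []; rewrite -{1}EpE => -[q Eq qp]; exists q.
  - move=> q r [Eq qp] [Er rp]; split; first exact: sE.
    by rewrite -mulgA rp qp.
by have : E p by []; rewrite -{1}stE => -[].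
Qed.

Lemma stabilizer_idempotent (Y : topologicalType) (b : beta_action G Y) (y : Y)
    (C : set (beta G)) :
  hausdorff_space Y -> closed C -> subsemigroup C -> recurrent b C y ->
  exists u, [/\ C u, u * u = u & b u y = y].
Proof.
move=> hY cC sC [p Cp py].
have [|||u [Cu uy] uu] := @exists_idempotent [set p | C p /\ b p y = y].
- exact: closed_stabilizer.
- by exists p.
- move=> q r [Cq qy] [Cr ry]; split; first exact: sC.
  by rewrite -actA ry.
by exists u.
Qed.

(** Membership in a minimal left ideal, phrased without ideals: the left ideal
    generated by any [q * p] still contains [p]. *)
Definition minimal_uf p := forall q, exists r, r * (q * p) = p.

(** Any ideal [I] contains some [q], hence [q * p], hence [p = r * (q * p)]. *)
Lemma minimal_in_K p : minimal_uf p -> K (beta G) p.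
Proof.
move=> pmin I [[[q Iq] Iideal] _].
have [r <-] := pmin q; apply: (Iideal _ _ _).1.
exact: (Iideal _ _ Iq).2.
Qed.

Lemma minimal_mull p q : minimal_uf p -> minimal_uf (q * p).
Proof.
move=> pmin r; have [t tp] := pmin (r * q).
by exists (q * t); rewrite -mulgA; congr (_ * _); rewrite -{2}tp !mulgA.
Qed.

Lemma closed_left_ideal p : closed [set q * p | q in setT].
Proof.
apply: (@closed_orbit _ translation_action p (@uf_hausdorff G)).
exact: closedT.
Qed.

(** Any element of a minimal closed left ideal below [beta G * p] will do. *)
Lemma exists_minimal p : exists q, minimal_uf (q * p).
Proof.
have [| | |L [[cL [m Lm] Lid] Lp Lmin]] := @minimal_closed_set (beta G)
    [set L : set (beta G) | [/\ closed L, L !=set0 & forall q r, L r -> L (q * r)]]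
    [set q * p | q in setT] (@uf_compact G).
- by move=> L [].
- move=> F FP _ F0; split=> //; first by apply: closed_bigI => L /FP[].
  by move=> q r rF L FL; have [_ _] := FP L FL; apply; exact: rF.
- split; [exact: closed_left_ideal|by exists (p * p); exists p|].
  by move=> q _ [r _ <-]; exists (q * r); rewrite ?mulgA.
have [q _ qpm] := Lp m Lm; exists q; rewrite qpm => r.
have rmL : [set t * (r * m) | t in setT] = L.
  apply: Lmin; last by move=> _ [t _ <-]; exact: (Lid _ _ (Lid _ _ Lm)).
  split; [exact: closed_left_ideal|by exists (m * (r * m)); exists m|].
  by move=> t _ [t' _ <-]; exists (t * t'); rewrite ?mulgA.
by have : L m by []; rewrite -{1}rmL => -[t _ tm]; exists t.
Qed.

(** A minimal left ideal contains a left identity of each of its elements: the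
    elements of [beta G * p] that fix [q * p] form a closed subsemigroup. *)
Lemma minimal_left_unit p q : minimal_uf p ->
  exists r, (r * p) * (r * p) = r * p /\ (r * p) * (q * p) = q * p.
Proof.
move=> pmin; have [r rqp] := pmin (p * q).
have [|||_ [[t _ <-] tt tqp]] := @stabilizer_idempotent (beta G)
    translation_action (q * p) [set r * p | r in setT] (@uf_hausdorff G).
- exact: closed_left_ideal.
- by move=> _ _ [t _ <-] [t' _ <-]; exists (t * p * t'); rewrite ?mulgA.
- exists (q * r * p); first by exists (q * r).
  by rewrite /= -!mulgA [p * (q * p)]mulgA rqp.
by exists t.
Qed.

End BetaSemigroup.

(** * Sets missed by a whole left ideal *)

Section Countable.
Local Open Scope group_scope.

Variables (G : groupType) (idx : G -> nat).
Hypothesis idx_inj : injective idx.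
Implicit Types (p q r s t u : beta G) (A B C D V : set G).

(** [A] is negligible from the point of view of [u]: removing finitely many
    translates of [A] from a member of [u] leaves a member of [u]. *)
Definition null_for u A := forall g, ~ (principal g * u)%g A.

Lemma null_forE u A : null_for u A <-> forall g, u [set h | ~ A (g * h)].
Proof.
split=> uA g; have := uA g; rewrite uf_mul_principal; first by move/uf_setC.
by move/uf_setC.
Qed.

Lemma null_for0 u : null_for u set0.
Proof. by apply/null_forE => g; apply: ufS (ufT u) => h _ []. Qed.

Lemma null_for1 u h : (forall g, ~ u [set g]) -> null_for u [set h].
Proof.
move=> uN; apply/null_forE => g; apply/uf_setC => uh.
by apply: (uN (g^-1 * h)); apply: ufS uh => k /= <-; rewrite mulKg.
Qed.

Lemma null_forU u A B : null_for u A -> null_for u B -> null_for u (A `|` B).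
Proof. by move=> uA uB g /uf_setU[/uA|/uB]. Qed.

(** Recursive choice of sets [C n], where [C n] comes with its translates by the
    finitely many [g] such that [idx g <= n]. The union [V] of the earlier
    translates stays null for [u], and this is all that the next choice may use
    about [V]. *)
Lemma disjoint_translates u (P : nat -> set G -> Prop) :
  (forall n V, null_for u V -> exists C,
    [/\ null_for u C, P n C &
        forall g h, (idx g <= n)%N -> C h -> ~ V (g * h)]) ->
  exists C : nat -> set G, (forall n, P n (C n)) /\
    forall m n g h a b, (m < n)%N -> (idx g <= m)%N -> (idx h <= n)%N ->
      C m a -> C n b -> g * a <> h * b.
Proof.
move=> step.
have /choice[f fP] (nV : nat * set G) : exists C, null_for u nV.2 ->
    [/\ null_for u C, P nV.1 C &
        forall g h, (idx g <= nV.1)%N -> C h -> ~ nV.2 (g * h)].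
  have [/(step nV.1)[C CP]|] := pselect (null_for u nV.2); first by exists C.
  by exists set0.
pose fat n A := [set x | exists2 g, (idx g <= n)%N & A (g^-1 * x)].
pose V := fix V n := if n is m.+1 then V m `|` fat m (f (m, V m)) else set0.
have null_fat n A : null_for u A -> null_for u (fat n A).
  move=> /null_forE uA; apply/null_forE => g.
  apply: ufS (@uf_bigcap_le _ _ idx u
    (fun k => [set h | ~ A (k^-1 * g * h)]) n idx_inj _) => [h uAh [k kn]|k].
    by rewrite mulgA; exact: uAh.
  exact: uA.
have Vnull n : null_for u (V n).
  elim: n => [|n IH]; first exact: null_for0.
  by apply: null_forU => //; apply: null_fat; have [] := fP (n, V n) IH.
have VS m n a : (m < n)%N -> fat m (f (m, V m)) a -> V n a.
  move=> + fa; elim: n => // n IH; rewrite ltnS leq_eqVlt => /orP[/eqP<-|mn].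
    by right.
  by left; exact: IH.
exists (fun n => f (n, V n)); split=> [n|m n g h a b mn gm hn Ca Cb gahb].
  by have [] := fP (n, V n) (Vnull n).
have [_ _ /(_ h b hn Cb)] := fP (n, V n) (Vnull n); apply.
apply: VS mn _; exists g => //.
by rewrite -gahb mulKg.
Qed.

(** [beta G] is a free [G]-space. If [A] is maximal among the sets disjoint from
    their translate by [k], then [A], [k A] and [k^-1 A] cover [G], and one of
    them is in [t]. *)
Lemma free_translate t k : k <> 1 -> exists2 A, t A & forall a, A a -> ~ A (k * a).
Proof.
move=> k1.
have [F FP Ftot|A [AP Amax]] :=
    @Zorn_bigcup G [set A | forall a, A a -> ~ A (k * a)].
  move=> a [X FX Xa] [Y FY Ya].
  have [XY|YX] := Ftot _ _ FX FY; first by exact: (FP _ FY a (XY _ Xa)).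
  by exact: (FP _ FX a Xa (YX _ Ya)).
have cover h : A h \/ A (k^-1 * h) \/ A (k * h).
  apply: contrapT => /not_orP[nA /not_orP[nAV nAk]].
  apply: (Amax (A `|` [set h])).
    split; first by move=> a; left.
    by move=> /(_ h); apply: contra_not nA => H; apply: H; right.
  move=> a [Aa|->] [|].
  - exact: AP.
  - by move=> /= kah; apply: nAV; rewrite -kah mulKg.
  - by [].
  - by move=> /= kh; apply: k1; apply: (mulIg h); rewrite kh mul1g.
have : t (A `|` [set h | A (k^-1 * h)] `|` [set h | A (k * h)]).
  apply: ufS (ufT t) => h _; case: (cover h) => [?|[?|?]].
  - by left; left.
  - by left; right.
  - by right.
move=> /uf_setU[/uf_setU[]|] tA.
- by exists A.
- exists [set h | A (k^-1 * h)] => // a /= Aa; rewrite mulKg => Aa'.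
  by apply: AP Aa _; rewrite mulVKg.
- by exists [set h | A (k * h)] => // a /= Aa; exact: AP.
Qed.

(** By minimality each point of the compact left ideal [beta G * u] has a
    translate containing [B]; by compactness finitely many translations are
    enough for all points. *)
Lemma bounded_cover u B : minimal_uf u -> u B -> exists n, forall q,
  (q * u)%g [set h | exists2 g, (idx g <= n)%N & B (g * h)].
Proof.
move=> umin uB; apply: contrapT => /forallNP H.
have /choice[q qP] n : exists q,
    ~ (q * u)%g [set h | exists2 g, (idx g <= n)%N & B (g * h)].
  by apply/existsNP; exact: H.
have [|s [q0 _ <-] slim] := @uf_limit G _ (fun n => q n * u) (@closed_left_ideal G u).
  by move=> n; exists (q n).
have [r rq0] := umin q0.
have : (r * (q0 * u))%g B by rewrite rq0.
rewrite uf_mulE => /uf_ex[g].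
suff /uf_setC : (q0 * u)%g (~` [set h | B (g * h)]) by [].
apply: (slim _ (idx g)) => n gn.
have /uf_setC := qP n; apply: ufS => h nB Bh; apply: nB.
by exists g.
Qed.

(** Finitely many translates of [B] cover a set [T] that belongs to all the
    elements of [beta G * u]; such a [T] contains right translates
    [E_m * h_m] of the growing finite sets [E_m] given by [idx g <= m]. These
    can be chosen disjoint. The union [Th true] of those with [m] odd and the
    union [Th false] of those with [m] even each contain a left ideal, that is,
    belong to all the elements of that ideal. Since [Th true] and [Th false] are
    disjoint, at least one of the two left ideals misses [beta G * u]. It
    contains a minimal ultrafilter, which contains [T] and hence a translate of
    [B]; translating it back puts [B] in it. *)
Lemma minimal_nearby u B : minimal_uf u -> (forall g, ~ u [set g]) -> u B ->
  exists t A, [/\ minimal_uf t, t B, t A & null_for u A].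
Proof.
move=> umin uN uB.
have [n uT] := bounded_cover umin uB.
set T := [set h | _] in uT.
have [m V /null_forE Vnull|C [CP Cdisj]] := @disjoint_translates u
    (fun m C => exists2 h, C = [set h] & forall g, (idx g <= m)%N -> T (g * h)).
  have uTV g : u ([set h | T (g * h)] `&` [set h | ~ V (g * h)]).
    by apply: ufI (Vnull g); rewrite -uf_mul_principal.
  have [h hP] := uf_ex (uf_bigcap_le m idx_inj uTV).
  exists [set h]; split; first exact: null_for1.
    by exists h => // g gm; have [] := hP g gm.
  by move=> g _ gm ->; have [] := hP g gm.
have /choice[h hP] m : exists h : G, C m = [set h] /\
    forall g, (idx g <= m)%N -> T (g * h).
  by have [h] := CP m; exists h.
pose Th (b : bool) :=
  [set x | exists g m, [/\ odd m = b, (idx g <= m)%N & x = g * h m]].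
have ThT b : Th b `<=` T.
  by move=> _ [g [m [_ gm ->]]]; apply: (hP m).2.
have Thdisj x : Th true x -> Th false x -> False.
  move=> [g [m [om gm ->]]] [g' [m' [om' gm']]].
  have Ch k : C k (h k) by rewrite (hP k).1.
  have [mm'|m'm|mm'] := ltngtP m m'.
  - exact: Cdisj mm' gm gm' (Ch m) (Ch m').
  - by move/esym; exact: Cdisj m'm gm' gm (Ch m') (Ch m).
  - by move: om; rewrite mm' om'.
have /choice[p pP] b : exists p, forall q, (q * p)%g (Th b).
  have [//|//|p _ plim] := @uf_limit G setT (fun k => principal (h (b + k.*2)%N)).
  exists p => q; rewrite uf_mulE; apply: ufS (ufT q) => g _ /=.
  apply: (plim _ (idx g)) => k gk; apply/principal_filterP.
  exists g, (b + k.*2)%N; split=> //; first by rewrite oddD odd_double addbF oddb.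
  by rewrite (leq_trans gk)// -addnn addnA leq_addl.
(* By minimality, a left ideal that meets the one of [u] contains [u]. *)
have [b pb] : exists b, forall q r, q * p b <> r * u.
  apply: contrapT => /forallNP H.
  have uTh b : u (Th b).
    have /existsNP[q /existsNP[r /contrapT qpru]] := H b.
    have [r' <-] := umin r; rewrite -qpru mulgA; exact: pP.
  have [x [xt xf]] := uf_ex (ufI (uTh true) (uTh false)).
  exact: Thdisj xt xf.
have [q qpmin] := exists_minimal (p b).
have [g gB] : exists g, (principal g * (q * p b))%g B.
  apply: contrapT => /forallNP nB.
  have nB' g : (q * p b)%g (~` [set h | B (g * h)]).
    by apply/uf_setC; rewrite -uf_mul_principal.
  have [x [xB xT]] := uf_ex (ufI (uf_bigcap_le n idx_inj nB') (pP b q)).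
  by have [g gn Bgx] := ThT _ _ xT; exact: xB g gn Bgx.
exists (principal g * (q * p b)).
(* The left ideal of [u] is closed, so a neighbourhood of [t] misses it. *)
have [A [tA nA]] : exists A, (principal g * (q * p b))%g A /\ forall r, ~ (r * u)%g A.
  apply: contrapT => /forallNP H.
  have [r _ rup] : [set r * u | r in setT] (principal g * (q * p b)).
    apply: (@closed_left_ideal G u) => W /nbhs_ufP[A tA AW].
    have /not_andP[//|/existsNP[r /contrapT ruA]] := H A.
    by exists (r * u); split; [exists r|exact: AW].
  by apply: (pb (principal g * q) r); rewrite rup mulgA.
exists A; split=> //; exact: minimal_mull.
Qed.

(** * Branching sets *)

(** The tree with root [1] in which the children of [g] are the [g * a] with [a]
    in [A g]. *)
Inductive branching (A : G -> set G) : G -> Prop :=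
| branching_root : branching A 1
| branching_step g a : branching A g -> A g a -> branching A (g * a).

(** Disjointness of the sets [g A_g] means that each element has at most one
    parent. So for [a] in [A g], the element [g * a] is in the tree exactly when
    [g] is. *)
Lemma branching_recurrent s (A : G -> set G) :
  (forall g, s (A g)) ->
  (forall g a, A g a -> g * a <> 1) ->
  (forall g h a b, g <> h -> A g a -> A h b -> g * a <> h * b) ->
  forall g, s [set h | branching A (g * h)] <-> branching A g.
Proof.
move=> sA A1 Adisj g; split=> [sF|Fg]; last first.
  by apply: ufS (sA g) => a; exact: branching_step.
apply: contrapT => nF; have [a [Aa /=]] := uf_ex (ufI (sA g) sF).
move eqx : (g * a) => x Fx; case: Fx eqx => [|h b Fh Ab] gahb.
  exact: A1 Aa gahb.
by apply: Adisj Aa Ab gahb => gh; apply: nF; rewrite gh.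
Qed.

(** The standard shrinking of a member of an idempotent, as in the
    Galvin-Glazer proof of Hindman's theorem: it makes the condition on [D] pass
    from [g] to its children [g * a]. *)
Lemma idempotent_star u D : u * u = u -> u D ->
  exists D', [/\ D' `<=` D, u D' & forall g, D' g -> u [set h | D' (g * h)]].
Proof.
move=> uu uD; exists (D `&` [set g | u [set h | D (g * h)]]).
have uD1 : u [set g | u [set h | D (g * h)]] by rewrite -uf_mulE uu.
split; [by move=> g []|exact: ufI|].
move=> g [_ uDg]; apply: ufI => //=.
have : (u * u)%g [set h | D (g * h)] by rewrite uu.
rewrite uf_mulE; apply: ufS => h.
by apply: ufS => k /=; rewrite mulgA.
Qed.

(** The sets [C n] are members of minimal ultrafilters [t n], the ultrafilter [s]
    is a limit of the [t n], and the children of [g] are given by the union [A g]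
    of the [C n] with [idx g <= n], which belongs to [s] as it belongs to almost
    all [t n]. The translates of [C m] and [C n] are disjoint by the recursive
    choice when [m] and [n] differ, and by freeness of the translations when
    [m = n]. *)
Lemma sparse_recurrent_set (S : set (beta G)) u D :
  closed S -> (forall t, minimal_uf t -> S t) ->
  (forall t, S t -> forall g, ~ t [set g]) ->
  minimal_uf u -> u * u = u -> u D ->
  exists F s, [/\ S s, F 1, forall g, F g -> g = 1 \/ D g &
                  forall g, s [set h | F (g * h)] <-> F g].
Proof.
move=> cS minS SN umin uu /(idempotent_star uu)[D' [D'D uD' D'star]].
have uN := SN u (minS u umin).
have [n V Vnull|C [CP Cdisj]] := @disjoint_translates u (fun n C =>
  [/\ exists2 t, minimal_uf t & t C,
       forall g a, (idx g <= n)%N -> C a -> g = 1 \/ D' g -> D' (g * a),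
       forall g a, (idx g <= n)%N -> C a -> g * a <> 1 &
       forall g h a b, (idx g <= n)%N -> (idx h <= n)%N -> g <> h ->
         C a -> C b -> g * a <> h * b]).
  (* The conditions on [C n] that are met by [u]-many [a]. *)
  pose P g := [set a | g = 1 \/ D' g -> D' (g * a)] `&`
    ([set a | g * a <> 1] `&` [set a | ~ V (g * a)]).
  have uP g : u (P g).
    apply: ufI; last apply: ufI.
    - have [[->|/D'star uDg]|ng] := pselect (g = 1 \/ D' g).
      + by apply: ufS uD' => a D'a _; rewrite /= mul1g.
      + by apply: ufS uDg => a Dga _.
      + by apply: ufS (ufT u) => a _ /ng.
    - apply: ufS ((uf_setC u [set g^-1]).2 (uN _)) => a /= na ga.
      by apply: na; rewrite -[a](mulKg g) ga mulg1.
    - by move/null_forE: Vnull; apply.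
  have [t [A [tmin tP tA uA]]] := minimal_nearby umin uN (uf_bigcap_le n idx_inj uP).
  (* Freeness concerns [t], not [u]: it is imposed after the choice of [t]. *)
  have /choice[B BP] k : exists B, t B /\ (k <> 1 -> forall a, B a -> ~ B (k * a)).
    have [->|/(free_translate t)[B tB BP]] := pselect (k = 1); last by exists B.
    by exists setT; split=> //; exact: ufT.
  have tB := uf_bigcap_le n idx_inj
    (fun g => uf_bigcap_le n idx_inj (fun h => (BP (h^-1 * g)).1)).
  set B' := [set a | _] in tP; set B'' := [set a | _] in tB.
  exists (A `&` (B' `&` B'')); split; last by move=> g a gn [_ [/(_ g gn)[_ []]]].
    by move=> g gA; apply: (uA g); apply: ufS gA => a [].
  split.
  - by exists t => //; apply: ufI => //; exact: ufI.
  - by move=> g a gn [_ [/(_ g gn)[]]].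
  - by move=> g a gn [_ [/(_ g gn)[_ []]]].
  - move=> g h a b gn hn gh [_ [_ /(_ g gn h hn) aB]] [_ [_ /(_ g gn h hn) bB]] gahb.
    apply: (BP (h^-1 * g)).2 aB _.
      by move=> hg; apply: gh; apply: (mulgI h^-1); rewrite hg mulVg.
    by rewrite -mulgA gahb mulKg.
have /choice[t tP] n : exists t, minimal_uf t /\ t (C n).
  by have [[t tmin tC] _ _ _] := CP n; exists t.
have [n|s Ss slim] := @uf_limit G S t cS; first exact/minS/(tP n).1.
pose A g := [set a | exists2 n, (idx g <= n)%N & C n a].
have sA g : s (A g).
  apply: (slim _ (idx g)) => n gn; apply: ufS (tP n).2 => a Ca.
  by exists n.
exists (branching A), s; split=> //.
- exact: branching_root.
- suff FD g : branching A g -> g = 1 \/ D' g.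
    by move=> g /FD[->|/D'D]; [left|right].
  elim=> [|k a _ kD [n kn Ca]]; first by left.
  by right; have [_ CD _ _] := CP n; exact: CD kn Ca kD.
- apply: branching_recurrent => //.
  + by move=> g a [n gn Ca]; have [_ _ C1 _] := CP n; exact: C1.
  + move=> g h a b gh [m gm Ca] [n hn Cb].
    have [mn|nm|mn] := ltngtP m n.
    * exact: Cdisj mn gm hn Ca Cb.
    * by move/esym; exact: Cdisj nm hn gm Cb Ca.
    * rewrite mn in gm Ca; have [_ _ _ Cgh] := CP n.
      exact: Cgh gm hn gh Ca Cb.
Qed.

End Countable.

(** * The shift on subsets of G *)

Section Shift.
Local Open Scope group_scope.

Variable G : groupType.
Local Notation subsets := (prod_topology (fun _ : G => bool)).

(** Identifying [f] with a subset [F] of [G], this is the set of all [g] such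
    that [g^-1 F] is in [p]. *)
Definition shift (p : beta G) (f : subsets) : subsets :=
  fun g => `[< p [set h | f (g * h)] >].

Lemma shiftA p q f : shift p (shift q f) = shift (p * q) f.
Proof.
apply/funext => g; apply/asboolP/asboolP; rewrite uf_mulE; apply: ufS => h /=.
  by move/asboolP; apply: ufS => k /=; rewrite mulgA.
by move=> qf; apply/asboolP; apply: ufS qf => k /=; rewrite mulgA.
Qed.

(** A coordinate of [shift p f] depends only on which of a set and its complement
    belongs to [p]. *)
Lemma shift_continuous f : continuous (shift^~ f).
Proof.
move=> p; have pF : ProperFilter (shift^~ f @ p) :=
  fmap_proper_filter _ (nbhs_pfilter p).
apply/cvg_sup => g U [V [[W oW <-] Wpf] WU].
have agree (q : beta G) A : p A -> q A ->
    A = [set h | f (g * h)] \/ A = ~` [set h | f (g * h)] ->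
    shift q f g = shift p f g.
  move=> pA qA [] AE; rewrite AE in pA qA; apply/asboolP/asboolP => //.
    by move/uf_setC: qA.
  by move/uf_setC: pA.
apply/nbhs_ufP.
have [pf|/uf_setC pf] := pselect (p [set h | f (g * h)]).
  exists [set h | f (g * h)] => // q qf; apply: WU.
  by rewrite /= (agree q _ pf qf)//; left.
exists (~` [set h | f (g * h)]) => // q qf; apply: WU.
by rewrite /= (agree q _ pf qf)//; right.
Qed.

Definition shift_action : beta_action G subsets :=
  BetaAction shiftA shift_continuous.

Lemma subsets_compact : compact [set: subsets].
Proof.
have := @tychonoff G (fun=> bool) (fun=> setT) (fun=> bool_compact).
by congr compact; apply/seteqP; split.
Qed.

Lemma subsets_hausdorff : hausdorff_space subsets.
Proof. by apply: hausdorff_product => g; exact: discrete_hausdorff. Qed.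

Lemma shift_fixP (F : G -> Prop) s :
  shift_action s (fun g => `[< F g >]) = (fun g => `[< F g >]) <->
  forall g, s [set h | F (g * h)] <-> F g.
Proof.
have sE g : shift_action s (fun g => `[< F g >]) g = `[< s [set h | F (g * h)] >].
  by apply/asboolP/asboolP; apply: ufS => h /= /asboolP.
split=> [sF g|sF]; last by apply/funext => g; rewrite sE; apply: asbool_equiv_eq.
by apply: asbool_eq_equiv; rewrite -sE sF.
Qed.

End Shift.

(** * Distal points *)

Section Distal.
Local Open Scope group_scope.

Variables (G : groupType) (X : topologicalType) (a : beta_action G X).

(** The points [x] and [u x] are proximal, as both are sent to [u x] by [u]. *)
Lemma distal_idempotent (x : X) u : distal_point a x -> u * u = u -> a u x = x.
Proof.
move=> xd uu; apply: contrapT => ux.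
apply: (xd (a u x) _ ux); first by exists u.
by exists u; rewrite actA uu.
Qed.

Lemma distal_product_recurrent (S : set (beta G)) (x : X) :
  closed S -> subsemigroup S -> distal_point a x -> product_recurrent a S x.
Proof.
move=> cS sS xd Y b _ hY y yrec.
have [u [Su uu uy]] := stabilizer_idempotent hY cS sS yrec.
by exists u => //; rewrite /= /prod_act /= uy (distal_idempotent xd uu).
Qed.

(** Suppose that [p x = p y] with [y = q x]; replacing [p] by [m * p] we may take
    it minimal. An idempotent [u] of [beta G * p] fixes [x], so
    [y = (q u) x]. A left unit [v] of [q u] in [beta G * p] then fixes [y]; it
    also fixes [x], and [v x = v y]. *)
Lemma fixed_by_minimal_idempotents_distal (x : X) :
  (forall u, minimal_uf u -> u * u = u -> a u x = x) -> distal_point a x.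
Proof.
move=> fix_x y [q _ qx] yx [p pxy]; apply: yx.
have [m mmin] := exists_minimal p.
have left_ideal r : a (r * (m * p)) x = a (r * (m * p)) y.
  by rewrite -!actA pxy.
have fix_ideal r : r * (m * p) * (r * (m * p)) = r * (m * p) ->
    a (r * (m * p)) x = x.
  by apply: fix_x; exact: minimal_mull.
have [r [/fix_ideal ux _]] := minimal_left_unit m mmin.
have yE : y = a (q * r * (m * p)) x by rewrite -mulgA -actA ux.
have [t [/fix_ideal vx vqr]] := minimal_left_unit (q * r) mmin.
by rewrite -vx left_ideal yE actA vqr.
Qed.

(** If [u x <> x], then [x] and the tree of [sparse_recurrent_set] have no common
    return time in [S]: such a [t] would contain the tree, which has [1] as an
    element, hence [D], being nonprincipal. *)
Lemma product_recurrent_minimal_idempotent (S : set (beta G)) (x : X) u :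
  countable [set: G] -> hausdorff_space X -> closed S ->
  (forall t, minimal_uf t -> S t) ->
  (forall t, S t -> forall g, ~ t [set g]) ->
  product_recurrent a S x -> minimal_uf u -> u * u = u -> a u x = x.
Proof.
move=> /countable_injP[idx idx_inj] hX cS minS SN xrec umin uu.
apply: contrapT => uxx.
have [D uD Dx] : exists2 D, u D & forall t : beta G, t D -> a t x <> x.
  have /(@act_continuous _ _ a x u)/nbhs_ufP[D uD DU] : nbhs (a u x) (~` [set x]).
    apply: open_nbhs_nbhs; split=> //; apply: closed_openC.
    exact: accessible_closed_set1 (hausdorff_accessible hX) _.
  by exists D.
have {}idx_inj : injective idx by move=> g h /idx_inj; apply; rewrite inE.
have [F [s [Ss F1 FD sF]]] := sparse_recurrent_set idx_inj cS minS SN umin uu uD.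
have [|t St [tx /shift_fixP tF]] := xrec _ (shift_action G)
    (@subsets_compact G) (@subsets_hausdorff G) (fun g => `[< F g >]).
  by exists s => //; exact/shift_fixP.
apply: (Dx t) tx.
have tF1 : t [set h | F (1 * h)] by exact/tF.
have tn1 : t (~` [set 1]) by apply/uf_setC; exact: SN.
apply: ufS (ufI tF1 tn1) => g [/=]; rewrite mul1g => /FD[->//|//].
Qed.

End Distal.

Theorem theorem1p6 (G : groupType) (X : topologicalType)
    (a : beta_action G X) (S : set (beta G)) :
  countable [set: G] -> infinite_set [set: G] ->
  compact [set: X] -> hausdorff_space X ->
  S !=set0 -> closed S -> subsemigroup S ->
  S `<=` ~` range (@principal G) ->
  K (beta G) `<=` S ->
  forall x : X, distal_point a x <-> product_recurrent a S x.
Proof.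
move=> cG _ _ hX _ cS sS SG KS x; split.
  exact: distal_product_recurrent.
move=> xrec; apply: fixed_by_minimal_idempotents_distal => u umin uu.
apply: (product_recurrent_minimal_idempotent cG hX cS _ _ xrec umin uu).
  by move=> t /minimal_in_K/KS.
move=> t St g tg; apply: (SG t St); exists g => //; apply: uf_eqP => A.
split=> [/principal_filterP Ag|tA]; first by apply: ufS tg => _ ->.
by apply/principal_filterP; have [_ [-> ]] := uf_ex (ufI tg tA).
Qed.
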